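(* Let $(\mathcal{M},\varphi,\xi,\eta,g)$ be a weakly para-cosymplectic manifold with para-K\''ahler leaves. Then its Ricci form $\rho$, $\rho(X,Y)=Ric(\varphi X,Y)$, is closed: $d\rho=0$.
   Context: All manifolds, tensor fields and functions are smooth. An almost para-contact metric structure on a manifold $\mathcal{M}$ of dimension $2n+1\geqslant 3$ is a quadruple $(\varphi,\xi,\eta,g)$ consisting of a $(1,1)$-tensor field $\varphi$, a vector field $\xi$, a 1-form $\eta$ and a pseudo-Riemannian metric $g$ with $\varphi^2=Id-\eta\otimes\xi$, $\eta(\xi)=1$, $g(\varphi X,\varphi Y)=-g(X,Y)+\eta(X)\eta(Y)$, $\eta(X)=g(\xi,X)$. The fundamental form is the 2-form $\varPhi(X,Y)=g(\varphi X,Y)$. The manifold is almost para-cosymplectic if $d\eta=0$ and $d\varPhi=0$; an almost para-cosymplectic manifold is weakly para-cosymplectic if $R(X,Y)\varphi Z=\varphi R(X,Y)Z$ for all $X,Y,Z$, where $R(X,Y)Z=\nabla_X\nabla_YZ-\nabla_Y\nabla_XZ-\nabla_{[X,Y]}Z$ is the curvature of the Levi-Civita connection $\nabla$ of $g$. $Ric(X,Y)=\mathrm{Tr}\{Z\mapsto R(Z,X)Y\}$. Each leaf of the foliation $\eta=0$ inherits an almost para-Hermitian structure $(P,H)$ by restricting $\varphi$ and $g$; the manifold has para-K\''ahler leaves if $P$ is parallel for the Levi-Civita connection of $H$ on every leaf, equivalently $(\nabla_X\varphi)Y=g(A\varphi X,Y)\xi-\eta(Y)A\varphi X$ where $A=-\nabla\xi$.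 On a weakly para-cosymplectic manifold $Ric(\varphi X,Y)=-Ric(X,\varphi Y)$, so that $\rho$ is indeed a 2-form. *)

(* Defs.v *)
From HB Require Import structures.
From mathcomp Require Import all_boot all_order all_algebra.
From mathcomp Require Import all_classical all_reals all_analysis.
From mathcomp Require Import ring.

Set Implicit Arguments.
Unset Strict Implicit.
Unset Printing Implicit Defensive.

Import Order.TTheory GRing.Theory Num.Theory.
Import numFieldNormedType.Exports.

Local Open Scope classical_set_scope.
Local Open Scope ring_scope.

(* Tangent vectors are row vectors, as for the library's Jacobian 'J: the     *)
(* differential of f at x is v |-> v *m 'J f x. Accordingly a (1,1)-tensor P  *)
(* acts by v |-> v *m P (so products of matrices compose from left to right), *)
(* a covector a is a column, a(v) = v *m a, and a bilinear form b is a matrix *)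
(* with b(v, w) = v *m b *m w^T.                                              *)

Definition frame (R : realType) (m : nat) (i : 'I_m) (x : 'rV[R]_m) : 'rV[R]_m :=
  delta_mx 0 i.

Definition pd (R : realType) (m : nat) (V : normedModType R) (i : 'I_m)
    (f : 'rV[R]_m -> V) (x : 'rV[R]_m) : V :=
  'D_(delta_mx 0 i) f x.

(* f is of class C^k on U; only used for open U. *)
Fixpoint class_C (R : realType) (m : nat) (V : normedModType R) (k : nat)
    (U : set 'rV[R]_m) (f : 'rV[R]_m -> V) : Prop :=
  (forall x, U x -> {for x, continuous f}) /\
  (if k is k'.+1 then
     forall i : 'I_m,
       (forall x, U x -> derivable f x (delta_mx 0 i)) /\ class_C k' U (pd i f)
   else True).

Definition smooth (R : realType) (m : nat) (V : normedModType R)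
    (U : set 'rV[R]_m) (f : 'rV[R]_m -> V) : Prop :=
  forall k : nat, class_C k U f.

(* ch_to and ch_from are total functions that are meaningful only on ch_dom   *)
(* and ch_cod, where they are mutually inverse homeomorphisms.                *)
Record chart (R : realType) (m : nat) (M : topologicalType) := Chart {
  ch_dom : set M;
  ch_cod : set 'rV[R]_m;
  ch_to : M -> 'rV[R]_m;
  ch_from : 'rV[R]_m -> M;
  ch_dom_open : open ch_dom;
  ch_cod_open : open ch_cod;
  ch_to_cod : forall p, ch_dom p -> ch_cod (ch_to p);
  ch_from_dom : forall x, ch_cod x -> ch_dom (ch_from x);
  ch_toK : forall p, ch_dom p -> ch_from (ch_to p) = p;
  ch_fromK : forall x, ch_cod x -> ch_to (ch_from x) = x;
  ch_to_continuous : forall p, ch_dom p -> {for p, continuous ch_to};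
  ch_from_continuous : forall x, ch_cod x -> {for x, continuous ch_from}
}.

Definition transition (R : realType) (m : nat) (M : topologicalType)
    (c c' : chart R m M) : 'rV[R]_m -> 'rV[R]_m :=
  fun x => ch_to c' (ch_from c x).

Definition overlap (R : realType) (m : nat) (M : topologicalType)
    (c c' : chart R m M) : set 'rV[R]_m :=
  [set x | ch_cod c x /\ ch_dom c' (ch_from c x)].

(* The atlas is not required to be maximal: it determines a maximal one, and  *)
(* a tensor field is determined by its components in the charts of any atlas. *)
Record smooth_manifold (R : realType) (m : nat) := SmoothManifold {
  carrier :> topologicalType;
  carrier_hausdorff : hausdorff_space carrier;
  carrier_second_countable : @second_countable carrier;
  atlas : set (chart R m carrier);
  atlas_cover : forall p : carrier, exists2 c, atlas c & ch_dom c p;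
  atlas_compatible : forall c c', atlas c -> atlas c' ->
    smooth (overlap c c') (transition c c')
}.

(* A tensor field is given by its components in every chart of the atlas, a   *)
(* smooth function on the image of the chart, subject to the transformation   *)
(* law of its type; values at other charts and points are irrelevant.         *)
Section tensor_fields.
Variables (R : realType) (m : nat) (M : smooth_manifold R m).
Let rchart := chart R m M.

Definition smooth_components (V : normedModType R)
    (t : rchart -> 'rV[R]_m -> V) : Prop :=
  forall c, atlas c -> smooth (ch_cod c) (t c).

Definition vector_field (X : rchart -> 'rV[R]_m -> 'rV[R]_m) : Prop :=
  smooth_components X /\
  forall c c' x, atlas c -> atlas c' -> overlap c c' x ->
    X c' (transition c c' x) = X c x *m 'J (transition c c') x.

Definition one_form (a : rchart -> 'rV[R]_m -> 'cV[R]_m) : Prop :=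
  smooth_components a /\
  forall c c' x, atlas c -> atlas c' -> overlap c c' x ->
    a c x = 'J (transition c c') x *m a c' (transition c c' x).

Definition endomorphism_field (P : rchart -> 'rV[R]_m -> 'M[R]_m) : Prop :=
  smooth_components P /\
  forall c c' x, atlas c -> atlas c' -> overlap c c' x ->
    P c x *m 'J (transition c c') x =
    'J (transition c c') x *m P c' (transition c c' x).

Definition bilinear_field (b : rchart -> 'rV[R]_m -> 'M[R]_m) : Prop :=
  smooth_components b /\
  forall c c' x, atlas c -> atlas c' -> overlap c c' x ->
    b c x = 'J (transition c c') x *m b c' (transition c c' x)
              *m ('J (transition c c') x)^T.

Definition pseudo_riemannian_metric (g : rchart -> 'rV[R]_m -> 'M[R]_m) : Prop :=
  bilinear_field g /\
  forall c x, atlas c -> ch_cod c x -> (g c x)^T = g c x /\ g c x \in unitmx.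

End tensor_fields.

(* Pseudo-Riemannian geometry in local coordinates: g is the matrix of a      *)
(* metric on an open subset of R^m and vector fields are functions to R^m.    *)
Section local_geometry.
Variables (R : realType) (m : nat) (g : 'rV[R]_m -> 'M[R]_m).
Implicit Types X Y Z : 'rV[R]_m -> 'rV[R]_m.

(* The component Gamma^k_{ij} of the Levi-Civita connection. *)
Definition christoffel (x : 'rV[R]_m) (i j k : 'I_m) : R :=
  2^-1 * \sum_l invmx (g x) k l *
    (pd i (fun y => g y j l) x + pd j (fun y => g y i l) x
     - pd l (fun y => g y i j) x).

Definition nabla X Y (x : 'rV[R]_m) : 'rV[R]_m :=
  'D_(X x) Y x +
  \row_k \sum_i \sum_j christoffel x i j k * X x 0 i * Y x 0 j.

Definition lie_bracket X Y (x : 'rV[R]_m) : 'rV[R]_m :=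
  'D_(X x) Y x - 'D_(Y x) X x.

Definition curvature X Y Z (x : 'rV[R]_m) : 'rV[R]_m :=
  nabla X (nabla Y Z) x - nabla Y (nabla X Z) x - nabla (lie_bracket X Y) Z x.

Definition apply_endo (P : 'rV[R]_m -> 'M[R]_m) X (x : 'rV[R]_m) : 'rV[R]_m :=
  X x *m P x.

(* The row of index k is the image of the k-th coordinate vector field under  *)
(* Z |-> R(Z, X)Y.                                                            *)
Definition ricci X Y (x : 'rV[R]_m) : R :=
  \tr (\matrix_(k, l) curvature (frame k) X Y x 0 l).

Definition parallel_on (U : set 'rV[R]_m) (P : 'rV[R]_m -> 'M[R]_m) : Prop :=
  forall X Y, smooth U X -> smooth U Y -> forall x, U x ->
    nabla X (apply_endo P Y) x - apply_endo P (nabla X Y) x = 0.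

End local_geometry.

(* nabla is the Levi-Civita connection of g: it is torsion-free, and it is    *)
(* metric (stated on coordinate vector fields).                               *)
Section levi_civita.
Variables (R : realType) (m : nat) (g : 'rV[R]_m -> 'M[R]_m).
Variables (U : set 'rV[R]_m) (U_open : open U).
Hypothesis g_sym : forall x, U x -> (g x)^T = g x.
Hypothesis g_unit : forall x, U x -> g x \in unitmx.

Lemma pd_metricC x i j k : U x ->
  pd i (fun y => g y j k) x = pd i (fun y => g y k j) x.
Proof.
move=> Ux; rewrite /pd; apply: near_eq_derive.
near=> y; have Uy : U y by near: y; exact: open_nbhs_nbhs.
by rewrite -[in LHS](g_sym Uy) mxE.
Unshelve. all: by end_near. Qed.

Lemma christoffelC x i j k : U x ->
  christoffel g x i j k = christoffel g x j i k.
Proof.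
move=> Ux; rewrite /christoffel; congr (_ * _); apply: eq_bigr => l _.
by rewrite (pd_metricC l i j Ux) [X in X - _]addrC.
Qed.

Lemma christoffel_lower x i j k : U x ->
  \sum_l christoffel g x i j l * g x l k =
  2^-1 * (pd i (fun y => g y j k) x + pd j (fun y => g y i k) x
          - pd k (fun y => g y i j) x).
Proof.
move=> Ux; rewrite /christoffel.
under eq_bigr do rewrite -mulrA mulr_suml.
rewrite -mulr_sumr exchange_big /=; congr (_ * _).
have E r : \sum_l invmx (g x) l r * g x l k = (k == r)%:R.
  have /matrixP/(_ k r) := mulmxV (g_unit Ux); rewrite !mxE => <-.
  by apply: eq_bigr => l _; rewrite mulrC -{1}(g_sym Ux) mxE.
under eq_bigr do (under eq_bigr do rewrite mulrAC; rewrite -mulr_suml E).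
rewrite (bigD1 k) //= eqxx mul1r big1 ?addr0// => r rk.
by rewrite eq_sym (negbTE rk) mul0r.
Qed.

Lemma nabla_metric x i j k : U x ->
  pd i (fun y => g y j k) x =
  \sum_l christoffel g x i j l * g x l k + \sum_l christoffel g x i k l * g x j l.
Proof.
move=> Ux; rewrite christoffel_lower//.
have -> : \sum_l christoffel g x i k l * g x j l =
    \sum_l christoffel g x i k l * g x l j.
  by apply: eq_bigr => l _; rewrite -{1}(g_sym Ux) mxE.
rewrite christoffel_lower// -mulrDr (pd_metricC i k j Ux).
set a := pd i _ _; set b := pd j _ _; set c := pd k _ _.
have -> : a + b - c + (a + c - b) = 2 * a by ring.
by rewrite mulKf// pnatr_eq0.
Qed.

Lemma nabla_torsion X Y x : U x ->
  nabla g X Y x - nabla g Y X x = lie_bracket X Y x.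
Proof.
move=> Ux; rewrite /nabla /lie_bracket opprD addrACA -[RHS]addr0; congr (_ + _).
apply/rowP => k; rewrite !mxE exchange_big /=; apply/eqP; rewrite subr_eq0.
apply/eqP/eq_bigr => i _; apply: eq_bigr => j _.
by rewrite christoffelC// mulrAC.
Qed.

End levi_civita.

(* Components of exterior derivatives, up to the normalization factor, which  *)
(* does not matter for closedness. The formula for ext_d2 applies to 2-forms, *)
(* that is, when every w y is skew-symmetric.                                 *)
Definition ext_d1 (R : realType) (m : nat) (a : 'rV[R]_m -> 'cV[R]_m)
    (x : 'rV[R]_m) (i j : 'I_m) : R :=
  pd i (fun y => a y j 0) x - pd j (fun y => a y i 0) x.

Definition ext_d2 (R : realType) (m : nat) (w : 'rV[R]_m -> 'M[R]_m)
    (x : 'rV[R]_m) (i j k : 'I_m) : R :=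
  pd i (fun y => w y j k) x + pd j (fun y => w y k i) x
  + pd k (fun y => w y i j) x.

Definition closed_one_form (R : realType) (m : nat) (M : smooth_manifold R m)
    (a : chart R m M -> 'rV[R]_m -> 'cV[R]_m) : Prop :=
  forall c x, atlas c -> ch_cod c x -> forall i j, ext_d1 (a c) x i j = 0.

Definition closed_two_form (R : realType) (m : nat) (M : smooth_manifold R m)
    (w : chart R m M -> 'rV[R]_m -> 'M[R]_m) : Prop :=
  forall c x, atlas c -> ch_cod c x -> forall i j k, ext_d2 (w c) x i j k = 0.

Record almost_para_contact_metric (R : realType) (n : nat)
    (M : smooth_manifold R n.*2.+1) := AlmostParaContactMetric {
  phi : chart R n.*2.+1 M -> 'rV[R]_n.*2.+1 -> 'M[R]_n.*2.+1;
  xi : chart R n.*2.+1 M -> 'rV[R]_n.*2.+1 -> 'rV[R]_n.*2.+1;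
  eta : chart R n.*2.+1 M -> 'rV[R]_n.*2.+1 -> 'cV[R]_n.*2.+1;
  metric : chart R n.*2.+1 M -> 'rV[R]_n.*2.+1 -> 'M[R]_n.*2.+1;
  phi_tensor : endomorphism_field phi;
  xi_tensor : vector_field xi;
  eta_tensor : one_form eta;
  metric_tensor : pseudo_riemannian_metric metric;
  phi_square : forall c x, atlas c -> ch_cod c x ->
    phi c x *m phi c x = 1%:M - eta c x *m xi c x;
  eta_xi : forall c x, atlas c -> ch_cod c x ->
    xi c x *m eta c x = 1%:M;
  metric_phi : forall c x, atlas c -> ch_cod c x ->
    phi c x *m metric c x *m (phi c x)^T =
    - metric c x + eta c x *m (eta c x)^T;
  eta_metric : forall c x, atlas c -> ch_cod c x ->
    (eta c x)^T = xi c x *m metric c x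
}.

Section para_contact.
Variables (R : realType) (n : nat) (M : smooth_manifold R n.*2.+1).
Variable S : almost_para_contact_metric M.

Definition fundamental_form (c : chart R n.*2.+1 M) (x : 'rV[R]_n.*2.+1) :
    'M[R]_n.*2.+1 :=
  phi S c x *m metric S c x.

Definition almost_para_cosymplectic : Prop :=
  closed_one_form (eta S) /\ closed_two_form fundamental_form.

(* Curvature being tensorial, it is enough to let X, Y, Z range over the      *)
(* smooth vector fields of the charts.                                        *)
Definition weakly_para_cosymplectic : Prop :=
  almost_para_cosymplectic /\
  forall c, atlas c -> forall X Y Z : 'rV[R]_n.*2.+1 -> 'rV[R]_n.*2.+1,
    smooth (ch_cod c) X -> smooth (ch_cod c) Y -> smooth (ch_cod c) Z ->
    forall x, ch_cod c x ->
      curvature (metric S c) X Y (apply_endo (phi S c) Z) x =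
      apply_endo (phi S c) (curvature (metric S c) X Y Z) x.

(* f is the expression in the chart c of a local parametrization, with        *)
(* parameter domain V, of a leaf of the foliation eta = 0: an injective       *)
(* immersion of an open set of R^(2n) whose image is tangent to Ker eta. Such *)
(* maps are locally the inverses of the charts of the leaves.                 *)
Definition leaf_parametrization (c : chart R n.*2.+1 M) (V : set 'rV[R]_n.*2)
    (f : 'rV[R]_n.*2 -> 'rV[R]_n.*2.+1) : Prop :=
  [/\ open V,
      smooth V f,
      (forall u, V u -> ch_cod c (f u)),
      set_inj V f &
      forall u, V u -> row_free ('J f u) /\ 'J f u *m eta S c (f u) = 0].

Definition leaf_metric (c : chart R n.*2.+1 M)
    (f : 'rV[R]_n.*2 -> 'rV[R]_n.*2.+1) (u : 'rV[R]_n.*2) : 'M[R]_n.*2 :=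
  'J f u *m metric S c (f u) *m ('J f u)^T.

(* df(P v) = phi(df v); this determines P on V because df is injective. *)
Definition leaf_endomorphism (c : chart R n.*2.+1 M) (V : set 'rV[R]_n.*2)
    (f : 'rV[R]_n.*2 -> 'rV[R]_n.*2.+1) (P : 'rV[R]_n.*2 -> 'M[R]_n.*2) : Prop :=
  forall u, V u -> P u *m 'J f u = 'J f u *m phi S c (f u).

Definition para_kahler_leaves : Prop :=
  forall c V f P, atlas c -> leaf_parametrization c V f ->
    leaf_endomorphism c V f P -> parallel_on (leaf_metric c f) V P.

(* rho_ij = Ric(phi d_i, d_j). This is skew-symmetric on a weakly             *)
(* para-cosymplectic manifold, since Ric(phi X, Y) = - Ric(X, phi Y).         *)
Definition ricci_form (c : chart R n.*2.+1 M) (x : 'rV[R]_n.*2.+1) :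
    'M[R]_n.*2.+1 :=
  \matrix_(i, j) ricci (metric S c) (apply_endo (phi S c) (frame i)) (frame j) x.

End para_contact.

(* Main.v *)
(* Write Om for the curvature and phi for the structure endomorphism. If phi  *)
(* commutes with Om, the first Bianchi identity and the symmetries of Om give *)
(* rho(X, Y) = Tr(phi Om(X, Y)) / 2. By the second Bianchi identity, d rho is *)
(* then the cyclic sum of the Tr((D phi) Om) / 2, and each of these vanishes: *)
(* Om commutes with phi and is trivial in the direction of xi, while D phi    *)
(* anticommutes with phi on Ker eta, where phi^2 = 1.                         *)

From HB Require Import structures.
Require Import Defs.
From mathcomp Require Import all_boot all_order all_algebra.
From mathcomp Require Import all_classical all_reals all_analysis.
From mathcomp Require Import ring lra.

Set Implicit Arguments.
Unset Strict Implicit.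
Unset Printing Implicit Defensive.

Import Order.TTheory GRing.Theory Num.Theory.
Import numFieldNormedType.Exports.

Local Open Scope classical_set_scope.
Local Open Scope ring_scope.

(** * Mean value theorem and symmetry of second derivatives *)

Section directional_derivatives.
Variables (R : realType) (V : normedModType R).
Implicit Types (f : V -> R) (u v w x y : V).

Lemma is_derive_line f x u (s : R) : derivable f (x + s *: u) u ->
  is_derive s (1 : R) (fun t : R => f (x + t *: u)) ('D_u f (x + s *: u)).
Proof.
move=> fd.
have E : (fun h : R => h^-1 *: (((fun t : R => f (x + t *: u)) \o shift s) (h *: 1)
            - f (x + s *: u))) =
         (fun h : R => h^-1 *: ((f \o shift (x + s *: u)) (h *: u) - f (x + s *: u))).
  apply/funext => h /=; congr (_ *: (f _ - _)).
  by rewrite /shift /= scalerDl addrCA [h *: 1]mulr1.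
by apply: DeriveDef; rewrite /derivable /derive E.
Qed.

Lemma mean_value f x u (h : R) :
  (forall s : R, `|s| <= `|h| -> derivable f (x + s *: u) u) ->
  exists2 s : R, `|s| <= `|h| & f (x + h *: u) - f x = h * 'D_u f (x + s *: u).
Proof.
move=> fd; pose F (t : R) := f (x + t *: u).
have Fd s : `|s| <= `|h| -> is_derive s (1 : R) F ('D_u f (x + s *: u)).
  by move=> sh; apply: is_derive_line; exact: fd.
have F0 : F 0 = f x by rewrite /F scale0r addr0.
have Fc (a b : R) : (forall s, s \in `[a, b] -> `|s| <= `|h|) ->
    {within `[a, b], continuous F}.
  move=> ab; apply: derivable_within_continuous => s sI.
  by have [] := Fd s (ab s sI).
have [h0|h0|h0] := ltgtP h 0; last first.
- by exists 0; rewrite ?normr0// h0 scale0r addr0 subrr mul0r.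
- have sub s : s \in `[0, h] -> `|s| <= `|h|.
    by rewrite in_itv /= => /andP[s0 sh]; rewrite !ger0_norm// ltW.
  have [s sI E] := MVT h0 (fun s sI => Fd s (sub s (subset_itv_oo_cc sI))) (Fc _ _ sub).
  by exists s; [exact/sub/subset_itv_oo_cc | rewrite -F0 -/(F h) E subr0 mulrC].
- have sub s : s \in `[h, 0] -> `|s| <= `|h|.
    by rewrite in_itv /= => /andP[s0 sh]; rewrite !ler0_norm ?lerN2// ltW.
  have [s sI E] := MVT h0 (fun s sI => Fd s (sub s (subset_itv_oo_cc sI))) (Fc _ _ sub).
  exists s; [exact/sub/subset_itv_oo_cc | rewrite -F0 -/(F h) -opprB E].
  by rewrite sub0r mulrN opprK mulrC.
Qed.

Lemma is_derive_addZ f x u w (a dw : R) : is_derive x w f dw ->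
  (\forall y \near x, derivable f y u) -> {for x, continuous ('D_u f)} ->
  is_derive x (a *: u + w) f (a * 'D_u f x + dw).
Proof.
move=> fw fu cu.
suff cv : h^-1 *: ((f \o shift x) (h *: (a *: u + w)) - f x) @[h --> (0 : R)^'] -->
    a * 'D_u f x + dw.
  by apply: DeriveDef; [apply/cvg_ex; exists (a * 'D_u f x + dw) | exact/cvg_lim].
pose g (h : R) := h^-1 * (f (x + h *: w + (h * a) *: u) - f (x + h *: w)).
have -> : (fun h : R => h^-1 *: ((f \o shift x) (h *: (a *: u + w)) - f x)) =
    g \+ (fun h : R => h^-1 *: ((f \o shift x) (h *: w) - f x)).
  apply/funext => h; rewrite /g /shift /= [h *: w + x]addrC.
  rewrite -[_ + _ *: _ in RHS]/(_ + h^-1 * _) -mulrDr addrA subrK.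
  congr (_ *: (f _ - _)).
  by rewrite scalerDr scalerA addrC [RHS]addrAC addrA.
apply: cvgD; last first.
  have [d <-] := fw; exact: d.
apply/cvgrPdist_lt => e e0.
have [e' e'0 ae] : exists2 e' : R, 0 < e' & `|a| * e' < e.
  exists (e / (`|a| + 1)).
    by rewrite divr_gt0// ltr_pwDr.
  rewrite mulrCA gtr_pMr// ltr_pdivrMr ?ltr_pwDr// mul1r.
  by rewrite ltrDl ltr01.
have : \forall y \near x, derivable f y u /\ `|'D_u f x - 'D_u f y| < e'.
  near=> y; split; first by near: y.
  by near: y; move/cvgrPdist_lt : cu; apply.
move=> /nbhs_ballP[r /= r0 xr].
pose C := `|w| + `|a| * `|u| + 1.
have C0 : 0 < C by rewrite ltr_pwDr// addr_ge0// mulr_ge0.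
near=> h.
have hr (s : R) : `|s| <= `|h * a| -> ball x r (x + h *: w + s *: u).
  move=> sh; rewrite -ball_normE /ball_ /= -addrA opprD addNKr normrN.
  apply: (le_lt_trans (ler_normD _ _)); rewrite !normrZ.
  apply: (@le_lt_trans _ _ (`|h| * C)).
    rewrite /C mulrDr ler_wpDr// ?mulr1// mulrDr lerD2l.
    by rewrite mulrA ler_wpM2r// -normrM.
  rewrite -ltr_pdivlMr//; near: h; apply: dnbhs0_lt; exact: divr_gt0.
have h0 : h != 0 by near: h; exact: nbhs_dnbhs_neq.
have [s sh E] := @mean_value f (x + h *: w) u (h * a) (fun s sh => (xr _ (hr s sh)).1).
rewrite /g E mulrA mulKf// -mulrBr normrM.
apply: le_lt_trans ae; rewrite ler_wpM2l// ltW//.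
exact: (xr _ (hr s sh)).2.
Unshelve. all: by end_near.
Qed.

Lemma is_derive_translate f c x u : derivable f (x + c) u ->
  is_derive x u (fun z => f (z + c)) ('D_u f (x + c)).
Proof.
move=> fd.
have E : (fun h : R => h^-1 *: (((fun z => f (z + c)) \o shift x) (h *: u) - f (x + c))) =
         (fun h : R => h^-1 *: ((f \o shift (x + c)) (h *: u) - f (x + c))).
  by apply/funext => h /=; rewrite /shift /= addrA.
by apply: DeriveDef; rewrite /derivable /derive E.
Qed.

Lemma second_difference f x u v (h : R) :
  (forall s t : R, `|s| <= `|h| -> `|t| <= `|h| ->
     derivable f (x + s *: u + t *: v) u /\
     derivable ('D_u f) (x + s *: u + t *: v) v) ->
  exists s t : R, [/\ `|s| <= `|h|, `|t| <= `|h| &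
    f (x + h *: u + h *: v) - f (x + h *: u) - (f (x + h *: v) - f x) =
    h * (h * 'D_v ('D_u f) (x + s *: u + t *: v))].
Proof.
move=> fd; pose F z := f (z + h *: v) - f z.
have Fd (s : R) : `|s| <= `|h| -> is_derive (x + s *: u) u F
    ('D_u f (x + s *: u + h *: v) - 'D_u f (x + s *: u)).
  move=> sh; apply: is_deriveB.
    by apply: is_derive_translate; have [] := fd s h sh (lexx _).
  by apply/derivableP; have := (fd s 0 sh); rewrite normr0 scale0r addr0 => -[].
have [s sh] := @mean_value F x u h (fun s sh => @ex_derive _ _ _ _ _ _ _ (Fd s sh)).
rewrite (@derive_val _ _ _ _ _ _ _ (Fd s sh)) => ->.
have [t th ->] := @mean_value ('D_u f) (x + s *: u) v h (fun t th => (fd s t sh th).2).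
by exists s, t.
Qed.

Lemma schwarz f x u v :
  (\forall y \near x, derivable f y u /\ derivable ('D_u f) y v) ->
  (\forall y \near x, derivable f y v /\ derivable ('D_v f) y u) ->
  {for x, continuous ('D_v ('D_u f))} -> {for x, continuous ('D_u ('D_v f))} ->
  'D_v ('D_u f) x = 'D_u ('D_v f) x.
Proof.
move=> fuv fvu cuv cvu; apply/eqP; rewrite -subr_eq0 -normr_le0.
apply/ler_addgt0Pr => e e0; rewrite add0r.
have e20 : 0 < e / 2 by rewrite divr_gt0.
have : \forall y \near x,
    [/\ derivable f y u /\ derivable ('D_u f) y v,
        derivable f y v /\ derivable ('D_v f) y u,
        `|'D_v ('D_u f) x - 'D_v ('D_u f) y| < e / 2 &
        `|'D_u ('D_v f) x - 'D_u ('D_v f) y| < e / 2].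
  move/cvgrPdist_lt/(_ _ e20) : cuv => cuv.
  move/cvgrPdist_lt/(_ _ e20) : cvu => cvu.
  apply: filterS _ (filterI (filterI fuv fvu) (filterI cuv cvu)).
  move=> y [[A B] [C D]]; apply: (And4 A B C D).
move=> /nbhs_ballP[r /= r0 xr].
pose C := `|u| + `|v| + 1.
have C0 : 0 < C by rewrite ltr_pwDr// addr_ge0.
pose h := r / 2 / C.
have h0 : 0 < h by rewrite !divr_gt0.
have hC : h * C < r by rewrite /h mulfVK ?gt_eqF// ltr_pdivrMr// ltr_pMr// ltr1n.
have hr (s t : R) : `|s| <= `|h| -> `|t| <= `|h| -> ball x r (x + s *: u + t *: v).
  rewrite (gtr0_norm h0) => sh th.
  rewrite -ball_normE /ball_ /= -addrA opprD addNKr normrN.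
  apply: (le_lt_trans (ler_normD _ _)); rewrite !normrZ.
  apply: le_lt_trans hC; rewrite /C [leRHS]mulrDr ler_wpDr//.
    by rewrite mulr1 ltW.
  by rewrite mulrDr lerD// ler_wpM2r.
have hr' (s t : R) : `|s| <= `|h| -> `|t| <= `|h| -> ball x r (x + s *: v + t *: u).
  by move=> sh th; rewrite addrAC; exact: hr.
have [s [t [sh th E]]] := @second_difference f x u v h
  (fun s t sh th => let: And4 p _ _ _ := xr _ (hr s t sh th) in p).
have [s' [t' [sh' th' E']]] := @second_difference f x v u h
  (fun s t sh th => let: And4 _ p _ _ := xr _ (hr' s t sh th) in p).
have EE : 'D_v ('D_u f) (x + s *: u + t *: v) =
          'D_u ('D_v f) (x + s' *: v + t' *: u).
  apply: (mulfI (lt0r_neq0 h0)); apply: (mulfI (lt0r_neq0 h0)).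
  apply: etrans (esym E) (etrans _ E').
  by rewrite [x + h *: v + _]addrAC !opprB addrACA [RHS]addrACA [- _ - _]addrC.
have [_ _ A _] := xr _ (hr s t sh th).
have [_ _ _ B] := xr _ (hr' s' t' sh' th').
rewrite EE in A.
rewrite -(subrKA ('D_u ('D_v f) (x + s' *: v + t' *: u))).
apply: (le_trans (ler_normD _ _)).
rewrite [leRHS]splitr; apply: lerD; apply: ltW; first exact: A.
by rewrite distrC; exact: B.
Qed.

End directional_derivatives.

(** * Smooth functions *)

Section smooth_functions.
Variables (R : realType) (m : nat) (U : set 'rV[R]_m).
Hypothesis U_open : open U.
Implicit Types (f g : 'rV[R]_m -> R) (x v : 'rV[R]_m).

Lemma open_near (P : 'rV[R]_m -> Prop) x :
  U x -> (forall y, U y -> P y) -> \forall y \near x, P y.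
Proof. by move=> Ux UP; apply: filterS UP _; exact: open_nbhs_nbhs. Qed.

Lemma pd_eq (V : normedModType R) (f g : 'rV[R]_m -> V) i x : U x ->
  (forall y, U y -> f y = g y) -> pd i f x = pd i g x.
Proof. by move=> Ux fg; apply: near_eq_derive; exact: (open_near Ux fg). Qed.

Lemma class_C_continuous (V : normedModType R) k (f : 'rV[R]_m -> V) x :
  class_C k U f -> U x -> {for x, continuous f}.
Proof. by case: k => [|k] [fc _]; exact: fc. Qed.

Lemma class_C_eq (V : normedModType R) k (f g : 'rV[R]_m -> V) :
  (forall x, U x -> f x = g x) -> class_C k U f -> class_C k U g.
Proof.
have fgc (f' g' : 'rV[R]_m -> V) : (forall x, U x -> f' x = g' x) ->
    (forall x, U x -> {for x, continuous f'}) ->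
    (forall x, U x -> {for x, continuous g'}).
  move=> fg fc x Ux; rewrite /prop_for /continuous_at -fg//.
  exact: cvg_trans (@near_eq_cvg _ _ (nbhs x) _ _ _ (open_near Ux fg)) (fc x Ux).
elim: k f g => [|k IH] f g fg [fc fd]; split; try exact: fgc fc; first by [].
move=> i.
have [fd1 fd2] := fd i; split => [x Ux|].
  apply: near_eq_derivable _ (fd1 x Ux); exact: (open_near Ux fg).
by apply: IH fd2 => x Ux; exact: pd_eq.
Qed.

Lemma class_C_pred (V : normedModType R) k (f : 'rV[R]_m -> V) :
  class_C k.+1 U f -> class_C k U f.
Proof.
elim: k f => [|k IH] f [fc fd]; split => // i.
by have [fd1 fd2] := fd i; split; [exact: fd1 | exact: IH].
Qed.

Lemma class_C_coord p q k (F : 'rV[R]_m -> 'M[R]_(p, q)) a b :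
  class_C k U F -> class_C k U (fun y => F y a b).
Proof.
have cc (G : 'rV[R]_m -> 'M[R]_(p, q)) x : {for x, continuous G} ->
    {for x, continuous (fun y => G y a b)}.
  move=> Gc; apply: (@continuous_comp _ _ _ G (fun N : 'M[R]_(p, q) => N a b : R)).
    exact: Gc.
  exact: coord_continuous.
elim: k F => [|k IH] F [Fc Fd]; split; try by move=> x Ux; exact/cc/Fc.
  by [].
move=> i; have [Fd1 Fd2] := Fd i; split => [x Ux|].
  by have /derivable_mxP := Fd1 x Ux; exact.
apply: class_C_eq (IH _ Fd2) => x Ux.
by rewrite /pd derive_mx ?mxE//; exact: Fd1.
Qed.

Lemma class_C_cst (V : normedModType R) k (a : V) : class_C k U (fun=> a).
Proof.
elim: k a => [|k IH] a; (split; first by move=> x Ux; exact: cst_continuous) => // i.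
split => [x Ux|]; first exact: derivable_cst.
  by apply: class_C_eq (IH 0) => x Ux; rewrite /pd derive_cst.
Qed.

Lemma class_CD k f g : class_C k U f -> class_C k U g ->
  class_C k U (fun y => f y + g y).
Proof.
elim: k f g => [|k IH] f g [fc fd] [gc gd];
  (split; first by move=> x Ux; exact: (continuousD (fc x Ux) (gc x Ux))) => // i.
have [fd1 fd2] := fd i; have [gd1 gd2] := gd i; split => [x Ux|].
  by apply: derivableD; [exact: fd1 | exact: gd1].
apply: class_C_eq (IH _ _ fd2 gd2) => x Ux.
by rewrite /pd [RHS]deriveD; [|exact: fd1 | exact: gd1].
Qed.

Lemma class_CM k f g : class_C k U f -> class_C k U g ->
  class_C k U (fun y => f y * g y).
Proof.
elim: k f g => [|k IH] f g fC gC; have [fc fd] := fC; have [gc gd] := gC;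
  (split; first by move=> x Ux; exact: (continuousM (fc x Ux) (gc x Ux))) => // i.
have [fd1 fd2] := fd i; have [gd1 gd2] := gd i; split => [x Ux|].
  by apply: derivableM; [exact: fd1 | exact: gd1].
apply: class_C_eq (class_CD (IH _ _ (class_C_pred fC) gd2) (IH _ _ (class_C_pred gC) fd2)) => x Ux.
by rewrite /pd [RHS]deriveM; [|exact: fd1 | exact: gd1].
Qed.

Lemma class_CV k f : (forall x, U x -> f x != 0) -> class_C k U f ->
  class_C k U (fun y => (f y)^-1).
Proof.
move=> f0; elim: k => [|k IH] fC; have [fc fd] := fC;
  (split; first by move=> x Ux; exact: (continuousV (f0 x Ux) (fc x Ux))) => // i.
have [fd1 fd2] := fd i; split => [x Ux|].
  by apply: derivableV; [exact: f0 | exact: fd1].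
have fV := IH (class_C_pred fC).
have := class_CM (class_C_cst k (-1 : R)) (class_CM (class_CM fV fV) fd2).
apply: class_C_eq => x Ux.
rewrite /pd [RHS]deriveV; [|exact: f0 | exact: fd1].
by rewrite mulN1r scaleNr expr2 invfM.
Qed.

Lemma smooth_pd f i : smooth U f -> smooth U (pd i f).
Proof. by move=> fs k; have [_ /(_ i)[]] := fs k.+1. Qed.

Lemma smooth_derivable f i x : smooth U f -> U x -> derivable f x (delta_mx 0 i).
Proof. by move=> fs Ux; have [_ /(_ i)[+ _]] := fs 1%N; exact. Qed.

Lemma smooth_eq f g : (forall x, U x -> f x = g x) -> smooth U f -> smooth U g.
Proof. by move=> fg fs k; apply: class_C_eq fg (fs k). Qed.

Lemma smooth_cst (a : R) : smooth U (fun=> a).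
Proof. by move=> k; exact: class_C_cst. Qed.

Lemma smoothD f g : smooth U f -> smooth U g -> smooth U (fun y => f y + g y).
Proof. by move=> fs gs k; exact: class_CD. Qed.

Lemma smoothM f g : smooth U f -> smooth U g -> smooth U (fun y => f y * g y).
Proof. by move=> fs gs k; exact: class_CM. Qed.

Lemma smoothN f : smooth U f -> smooth U (fun y => - f y).
Proof.
move=> fs; apply: smooth_eq (smoothM (smooth_cst (-1)) fs) => x _.
by rewrite mulN1r.
Qed.

Lemma smoothV f : (forall x, U x -> f x != 0) -> smooth U f ->
  smooth U (fun y => (f y)^-1).
Proof. by move=> f0 fs k; exact: class_CV. Qed.

Lemma smooth_sum (I : Type) (r : seq I) (P : pred I) (F : I -> 'rV[R]_m -> R) :
  (forall i, smooth U (F i)) -> smooth U (fun y => \sum_(i <- r | P i) F i y).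
Proof.
move=> Fs; elim: r => [|i r IH].
  by apply: smooth_eq (smooth_cst 0) => x _; rewrite big_nil.
case Pi: (P i).
  by apply: smooth_eq (smoothD (Fs i) IH) => x _; rewrite big_cons Pi.
by apply: smooth_eq IH => x _; rewrite big_cons Pi.
Qed.

Lemma smooth_prod (I : Type) (r : seq I) (F : I -> 'rV[R]_m -> R) :
  (forall i, smooth U (F i)) -> smooth U (fun y => \prod_(i <- r) F i y).
Proof.
move=> Fs; elim: r => [|i r IH].
  by apply: smooth_eq (smooth_cst 1) => x _; rewrite big_nil.
by apply: smooth_eq (smoothM (Fs i) IH) => x _; rewrite big_cons.
Qed.

Lemma pdD f g i x : smooth U f -> smooth U g -> U x ->
  pd i (fun y => f y + g y) x = pd i f x + pd i g x.
Proof. by move=> fs gs Ux; apply: deriveD; exact: smooth_derivable. Qed.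

Lemma pdM f g i x : smooth U f -> smooth U g -> U x ->
  pd i (fun y => f y * g y) x = pd i f x * g x + f x * pd i g x.
Proof.
move=> fs gs Ux; rewrite [LHS](deriveM (smooth_derivable fs Ux) (smooth_derivable gs Ux)).
by rewrite addrC; congr (_ + _); exact: mulrC.
Qed.

Lemma pd_cst (a : R) i x : pd i (fun=> a) x = 0.
Proof. exact: derive_cst. Qed.

Lemma pdN f i x : smooth U f -> U x -> pd i (fun y => - f y) x = - pd i f x.
Proof. by move=> fs Ux; apply: deriveN; exact: smooth_derivable. Qed.

Lemma pd_sum (I : Type) (r : seq I) (F : I -> 'rV[R]_m -> R) i x :
  (forall j, smooth U (F j)) -> U x ->
  pd i (fun y => \sum_(j <- r) F j y) x = \sum_(j <- r) pd i (F j) x.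
Proof.
move=> Fs Ux; elim: r => [|j r IH].
  rewrite big_nil -[RHS](pd_cst 0 i x); apply: pd_eq => // y _.
  by rewrite big_nil.
rewrite big_cons -IH -(pdD _ (Fs j) (smooth_sum r xpredT Fs) Ux).
by apply: pd_eq => // y _; rewrite big_cons.
Qed.

Lemma pdC f i j x : smooth U f -> U x -> pd i (pd j f) x = pd j (pd i f) x.
Proof.
move=> fs Ux; apply: schwarz.
- apply: open_near => // y Uy; apply: conj; first exact: smooth_derivable.
  exact: (smooth_derivable (smooth_pd _ fs)).
- apply: open_near => // y Uy; apply: conj; first exact: smooth_derivable.
  exact: (smooth_derivable (smooth_pd _ fs)).
- exact: (class_C_continuous (smooth_pd i (smooth_pd j fs) 0%N)).
- exact: (class_C_continuous (smooth_pd j (smooth_pd i fs) 0%N)).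
Qed.

Lemma is_derive_pd f x v : smooth U f -> U x ->
  is_derive x v f (\sum_i v 0 i * pd i f x).
Proof.
move=> fs Ux; rewrite {1}(row_sum_delta v).
elim: (index_enum _) => [|i r IH]; first by rewrite !big_nil; exact: is_derive0.
rewrite !big_cons; apply: is_derive_addZ IH _ _.
  by apply: open_near => // y Uy; exact: smooth_derivable.
exact: (class_C_continuous (smooth_pd i fs 0%N)).
Qed.

End smooth_functions.

Definition smooth_mx (R : realType) m p q (U : set 'rV[R]_m)
    (F : 'rV[R]_m -> 'M[R]_(p, q)) : Prop :=
  forall a b, smooth U (fun y => F y a b).

HB.lock Definition pd_mx (R : realType) m p q (i : 'I_m)
    (F : 'rV[R]_m -> 'M[R]_(p, q)) (x : 'rV[R]_m) : 'M[R]_(p, q) :=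
  \matrix_(a, b) pd i (fun y => F y a b) x.

Lemma pd_mxE (R : realType) m p q (i : 'I_m) (F : 'rV[R]_m -> 'M[R]_(p, q)) x a b :
  pd_mx i F x a b = pd i (fun y => F y a b) x.
Proof. by rewrite unlock mxE. Qed.

Section smooth_matrices.
Variables (R : realType) (m : nat) (U : set 'rV[R]_m).
Hypothesis U_open : open U.
Implicit Types (f : 'rV[R]_m -> R) (i j : 'I_m) (x v : 'rV[R]_m).

Lemma smooth_smooth_mx p q (F : 'rV[R]_m -> 'M[R]_(p, q)) :
  smooth U F -> smooth_mx U F.
Proof. by move=> Fs a b k; apply: class_C_coord. Qed.

Lemma smooth_mx_eq p q (F G : 'rV[R]_m -> 'M[R]_(p, q)) :
  (forall x, U x -> F x = G x) -> smooth_mx U F -> smooth_mx U G.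
Proof. by move=> FG Fs a b; apply: smooth_eq (Fs a b) => // x Ux; rewrite FG. Qed.

Lemma pd_mx_eq p q (F G : 'rV[R]_m -> 'M[R]_(p, q)) i x : U x ->
  (forall y, U y -> F y = G y) -> pd_mx i F x = pd_mx i G x.
Proof.
move=> Ux FG; apply/matrixP => a b; rewrite !(pd_mxE, mxE).
by apply: (pd_eq U_open _ Ux) => y Uy; rewrite FG.
Qed.

Lemma smooth_mx_cst p q (A : 'M[R]_(p, q)) : smooth_mx U (fun=> A).
Proof. by move=> a b; exact: smooth_cst. Qed.

Lemma pd_mx_cst p q (A : 'M[R]_(p, q)) i x : pd_mx i (fun=> A) x = 0.
Proof. by apply/matrixP => a b; rewrite !(pd_mxE, mxE) pd_cst. Qed.

Lemma smooth_mx_pd p q (F : 'rV[R]_m -> 'M[R]_(p, q)) i :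
  smooth_mx U F -> smooth_mx U (pd_mx i F).
Proof.
move=> Fs a b; apply: smooth_eq (smooth_pd i (Fs a b)) => // x _.
by rewrite !(pd_mxE, mxE).
Qed.

Lemma smooth_mxD p q (F G : 'rV[R]_m -> 'M[R]_(p, q)) :
  smooth_mx U F -> smooth_mx U G -> smooth_mx U (fun y => F y + G y).
Proof.
move=> Fs Gs a b; apply: smooth_eq (smoothD U_open (Fs a b) (Gs a b)) => // x _.
by rewrite !(pd_mxE, mxE).
Qed.

Lemma smooth_mxN p q (F : 'rV[R]_m -> 'M[R]_(p, q)) :
  smooth_mx U F -> smooth_mx U (fun y => - F y).
Proof.
move=> Fs a b; apply: smooth_eq (smoothN U_open (Fs a b)) => // x _.
by rewrite !(pd_mxE, mxE).
Qed.

Lemma smooth_mxT p q (F : 'rV[R]_m -> 'M[R]_(p, q)) :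
  smooth_mx U F -> smooth_mx U (fun y => (F y)^T).
Proof.
move=> Fs a b; apply: smooth_eq (Fs b a) => // x _.
by rewrite !(pd_mxE, mxE).
Qed.

Lemma smooth_mxM p q r (F : 'rV[R]_m -> 'M[R]_(p, q)) (G : 'rV[R]_m -> 'M[R]_(q, r)) :
  smooth_mx U F -> smooth_mx U G -> smooth_mx U (fun y => F y *m G y).
Proof.
move=> Fs Gs a b.
have FGs c : smooth U (fun y => F y a c * G y c b) by exact: smoothM.
apply: smooth_eq (smooth_sum U_open (index_enum _) xpredT FGs) => // x _.
by rewrite !(pd_mxE, mxE).
Qed.

Lemma smooth_mxZ p q f (F : 'rV[R]_m -> 'M[R]_(p, q)) :
  smooth U f -> smooth_mx U F -> smooth_mx U (fun y => f y *: F y).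
Proof.
move=> fs Fs a b; apply: smooth_eq (smoothM U_open fs (Fs a b)) => // x _.
by rewrite !(pd_mxE, mxE).
Qed.

Lemma smooth_mx_sum p q (I : Type) (r : seq I) (F : I -> 'rV[R]_m -> 'M[R]_(p, q)) :
  (forall c, smooth_mx U (F c)) -> smooth_mx U (fun y => \sum_(c <- r) F c y).
Proof.
move=> Fs a b.
apply: smooth_eq (smooth_sum U_open r xpredT (fun c => Fs c a b)) => // x _.
by rewrite summxE.
Qed.

Lemma smooth_det p (F : 'rV[R]_m -> 'M[R]_p) :
  smooth_mx U F -> smooth U (fun y => \det (F y)).
Proof.
move=> Fs; apply: smooth_sum => // s; apply: smoothM => //; first exact: smooth_cst.
by apply: smooth_prod.
Qed.

Lemma smooth_invmx p (F : 'rV[R]_m -> 'M[R]_p) :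
  (forall x, U x -> F x \in unitmx) -> smooth_mx U F ->
  smooth_mx U (fun y => invmx (F y)).
Proof.
move=> Fu Fs.
apply: (@smooth_mx_eq _ _ (fun y => (\det (F y))^-1 *: \adj (F y))).
  by move=> x Ux; rewrite /invmx Fu.
apply: smooth_mxZ.
  apply: smoothV => //; last exact: smooth_det.
  by move=> x Ux; have := Fu x Ux; rewrite unitmxE unitfE.
move=> a b; apply: (@smooth_eq _ _ _ U_open (fun y => cofactor (F y) b a)).
  by move=> x _; rewrite !(pd_mxE, mxE).
apply: smoothM => //; first exact: smooth_cst.
apply: smooth_det => c d.
by apply: smooth_eq (Fs (lift b c) (lift a d)) => // x _; rewrite !(pd_mxE, mxE).
Qed.

Lemma pd_mxD p q (F G : 'rV[R]_m -> 'M[R]_(p, q)) i x :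
  smooth_mx U F -> smooth_mx U G -> U x ->
  pd_mx i (fun y => F y + G y) x = pd_mx i F x + pd_mx i G x.
Proof.
move=> Fs Gs Ux; apply/matrixP => a b; rewrite !(pd_mxE, mxE) -(pdD _ (Fs a b) (Gs a b) Ux).
by apply: (pd_eq U_open _ Ux) => y _; rewrite !(pd_mxE, mxE).
Qed.

Lemma pd_mxN p q (F : 'rV[R]_m -> 'M[R]_(p, q)) i x :
  smooth_mx U F -> U x -> pd_mx i (fun y => - F y) x = - pd_mx i F x.
Proof.
move=> Fs Ux; apply/matrixP => a b; rewrite !(pd_mxE, mxE) -(pdN _ (Fs a b) Ux).
by apply: (pd_eq U_open _ Ux) => y _; rewrite !(pd_mxE, mxE).
Qed.

Lemma pd_mxT p q (F : 'rV[R]_m -> 'M[R]_(p, q)) i x : U x ->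
  pd_mx i (fun y => (F y)^T) x = (pd_mx i F x)^T.
Proof.
move=> Ux; apply/matrixP => a b; rewrite !(pd_mxE, mxE).
by apply: (pd_eq U_open _ Ux) => y _; rewrite !(pd_mxE, mxE).
Qed.

Lemma pd_mxM p q r (F : 'rV[R]_m -> 'M[R]_(p, q)) (G : 'rV[R]_m -> 'M[R]_(q, r)) i x :
  smooth_mx U F -> smooth_mx U G -> U x ->
  pd_mx i (fun y => F y *m G y) x = pd_mx i F x *m G x + F x *m pd_mx i G x.
Proof.
move=> Fs Gs Ux; apply/matrixP => a b; rewrite !(pd_mxE, mxE) -big_split /=.
have FGs c : smooth U (fun y => F y a c * G y c b) by exact: smoothM.
transitivity (pd i (fun y => \sum_c F y a c * G y c b) x).
  by apply: (pd_eq U_open _ Ux) => y _; rewrite !(pd_mxE, mxE).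
rewrite (pd_sum U_open)//; apply: eq_bigr => c _.
by rewrite (pdM _ (Fs _ _) (Gs _ _) Ux) !(pd_mxE, mxE).
Qed.

Lemma pd_mxZ p q f (F : 'rV[R]_m -> 'M[R]_(p, q)) i x :
  smooth U f -> smooth_mx U F -> U x ->
  pd_mx i (fun y => f y *: F y) x = pd i f x *: F x + f x *: pd_mx i F x.
Proof.
move=> fs Fs Ux; apply/matrixP => a b; rewrite !(pd_mxE, mxE) -(pdM _ fs (Fs a b) Ux).
by apply: (pd_eq U_open _ Ux) => y _; rewrite !(pd_mxE, mxE).
Qed.

Lemma pd_mx_sum p q (I : Type) (r : seq I) (F : I -> 'rV[R]_m -> 'M[R]_(p, q)) i x :
  (forall c, smooth_mx U (F c)) -> U x ->
  pd_mx i (fun y => \sum_(c <- r) F c y) x = \sum_(c <- r) pd_mx i (F c) x.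
Proof.
move=> Fs Ux; apply/matrixP => a b; rewrite summxE !(pd_mxE, mxE).
under [RHS]eq_bigr do rewrite !(pd_mxE, mxE).
rewrite -(pd_sum U_open _ _ (fun c => Fs c a b) Ux).
by apply: (pd_eq U_open _ Ux) => y _; rewrite summxE.
Qed.

Lemma pd_mxC p q (F : 'rV[R]_m -> 'M[R]_(p, q)) i j x :
  smooth_mx U F -> U x -> pd_mx i (pd_mx j F) x = pd_mx j (pd_mx i F) x.
Proof.
move=> Fs Ux; apply/matrixP => a b; rewrite [LHS]pd_mxE [RHS]pd_mxE.
transitivity (pd i (pd j (fun y => F y a b)) x).
  by apply: (pd_eq U_open _ Ux) => y _; rewrite !(pd_mxE, mxE).
rewrite (pdC U_open _ _ (Fs a b) Ux).
by apply: (pd_eq U_open _ Ux) => y _; rewrite !(pd_mxE, mxE).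
Qed.

Lemma pd_mxtrace p (F : 'rV[R]_m -> 'M[R]_p) i x : smooth_mx U F -> U x ->
  pd i (fun y => \tr (F y)) x = \tr (pd_mx i F x).
Proof.
move=> Fs Ux; rewrite /mxtrace (pd_sum U_open _ _ (fun a => Fs a a) Ux).
by under [RHS]eq_bigr do rewrite !(pd_mxE, mxE).
Qed.

Lemma derive_pd_mx p q (F : 'rV[R]_m -> 'M[R]_(p, q)) x v :
  smooth_mx U F -> U x -> 'D_v F x = \sum_i v 0 i *: pd_mx i F x.
Proof.
move=> Fs Ux; have Fd a b := is_derive_pd U_open v (Fs a b) Ux.
rewrite derive_mx; last by apply/derivable_mxP => a b; have [] := Fd a b.
apply/matrixP => a b; rewrite summxE !(pd_mxE, mxE) (@derive_val _ _ _ _ _ _ _ (Fd a b)).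
by apply: eq_bigr => i _; rewrite !(pd_mxE, mxE).
Qed.

End smooth_matrices.

(** * Linear algebra of curvature *)

Section matrix_entries.
Variables (R : pzRingType) (p q : nat) (A B : 'M[R]_(p, q)).

Lemma addmxE a b : (A + B) a b = A a b + B a b.
Proof. by rewrite mxE. Qed.

Lemma oppmxE a b : (- A) a b = - A a b.
Proof. by rewrite mxE. Qed.

End matrix_entries.

Lemma pair_symmetry (R : realFieldType) (I : Type) (K : I -> I -> I -> I -> R) :
  (forall i j k l, K i j k l = - K j i k l) ->
  (forall i j k l, K i j k l = - K i j l k) ->
  (forall i j k l, K i j k l + K j k i l + K k i j l = 0) ->
  forall i j k l, K i j k l = K k l i j.
Proof.
move=> K12 K34 cyc i j k l.
have := cyc i j k l; have := cyc j k l i; have := cyc k l i j; have := cyc l i j k.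
rewrite (K34 j k l i) (K34 k l j i) (K12 l j k i) (K34 j l k i) (K12 l i k j).
rewrite (K34 i l k j) (K34 i k l j) (K12 k i j l) (K12 l i j k) (K34 i j l k).
lra.
Qed.

Section para_contact_algebra.
Variables (R : realFieldType) (m : nat).
Variables (P g : 'M[R]_m) (xi : 'rV[R]_m) (eta : 'cV[R]_m).
Hypothesis g_sym : g^T = g.
Hypothesis P_square : P *m P = 1%:M - eta *m xi.
Hypothesis eta_xi : xi *m eta = 1%:M.
Hypothesis g_P : P *m g *m P^T = - g + eta *m eta^T.
Hypothesis eta_g : eta^T = xi *m g.

Lemma xi_endo : xi *m P = 0.
Proof.
have xiPP : xi *m P *m P = 0.
  by rewrite -mulmxA P_square mulmxBr mulmx1 mulmxA eta_xi mul1mx subrr.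
have etaP : eta *m (xi *m P) = P *m eta *m xi.
  have : P *m (P *m P) = P *m P *m P by rewrite mulmxA.
  rewrite P_square mulmxBl mulmxBr mul1mx mulmx1 !mulmxA => /addrI/oppr_inj.
  by move=> ->.
have [c E] : exists c, xi *m P = c *: xi.
  exists ((xi *m P *m eta) 0 0); rewrite -mul_scalar_mx -mx11_scalar.
  by rewrite -[LHS]mul1mx -eta_xi -mulmxA etaP !mulmxA.
move: xiPP; rewrite E -scalemxAl E scalerA => /eqP.
rewrite scaler_eq0 mulf_eq0 orbb => /orP[/eqP->|/eqP->].
  by rewrite scale0r.
by rewrite scaler0.
Qed.

Lemma endo_eta : P *m eta = 0.
Proof.
have : P *m (P *m P) = P *m P *m P by rewrite mulmxA.
rewrite P_square mulmxBl mulmxBr mul1mx mulmx1 => /addrI/oppr_inj E.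
move/(congr1 (mulmx^~ eta)): E => /=.
by rewrite -!mulmxA eta_xi mulmx1 [xi *m (P *m eta)]mulmxA xi_endo !mul0mx mulmx0.
Qed.

Lemma metric_endo : g *m P^T = - (P *m g).
Proof.
have := congr1 (mulmx P) g_P.
rewrite mulmxDr mulmxN [P *m (eta *m _)]mulmxA endo_eta mul0mx addr0 => <-.
rewrite !mulmxA P_square mulmxBl mul1mx mulmxBl -[eta *m xi *m g]mulmxA -eta_g.
by rewrite -mulmxA -trmx_mul endo_eta trmx0 mulmx0 subr0.
Qed.

Variable Om : 'M[R]_m.
Hypothesis Om_comm : P *m Om = Om *m P.
Hypothesis Om_skew : (Om *m g)^T = - (Om *m g).

Lemma xi_curv : xi *m Om = 0.
Proof.
have E : xi *m Om *m P = 0 by rewrite -mulmxA -Om_comm mulmxA xi_endo mul0mx.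
have xiOmeta : xi *m Om *m eta = 0.
  have etaE : eta = g *m xi^T by rewrite -[eta]trmxK eta_g trmx_mul g_sym.
  rewrite etaE mulmxA -[xi *m _ *m _]mulmxA; set s := _ *m _.
  have : s = - s.
    transitivity s^T; first by apply/matrixP => a b; rewrite [RHS]mxE !ord1.
    by rewrite /s trmx_mul [(xi *m _)^T]trmx_mul trmxK Om_skew mulNmx mulmxN mulmxA.
  move/eqP; rewrite -addr_eq0 -mulr2n -scaler_nat scaler_eq0 pnatr_eq0 /=.
  by move/eqP.
have := congr1 (mulmx^~ P) E; rewrite /= -mulmxA P_square mulmxBr mulmx1 mulmxA.
by rewrite xiOmeta !mul0mx subr0.
Qed.

Lemma curv_eta : Om *m eta = 0.
Proof.
have etaE : eta = g *m xi^T by rewrite -[eta]trmxK eta_g trmx_mul g_sym.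
rewrite etaE mulmxA -[Om *m g]opprK -Om_skew trmx_mul g_sym mulNmx -mulmxA.
by rewrite -trmx_mul xi_curv trmx0 mulmx0 oppr0.
Qed.

(* Up to terms in [xi] and [eta], a derivative [Q] of [P] interchanges the    *)
(* eigenspaces of [P] for 1 and -1, whereas [Om] preserves them.              *)
Lemma mxtrace_deriv_endo_curv (Q : 'M[R]_m) (a : 'cV[R]_m) (b : 'rV[R]_m) :
  Q *m P + P *m Q = - (a *m xi + eta *m b) -> \tr (Q *m Om) = 0.
Proof.
move=> QP.
have PPOm : P *m (P *m Om) = Om.
  by rewrite mulmxA P_square mulmxBl mul1mx -mulmxA xi_curv mulmx0 subr0.
have E : \tr (Q *m P *m (P *m Om)) = - \tr (P *m Q *m (P *m Om)).
  apply/eqP; rewrite -subr_eq0 opprK -raddfD -mulmxDl QP mulNmx mulmxDl.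
  rewrite -[a *m xi *m _]mulmxA Om_comm [xi *m _]mulmxA xi_curv mul0mx mulmx0 add0r.
  rewrite -[eta *m b *m _]mulmxA raddfN /= mxtrace_mulC -Om_comm -!mulmxA curv_eta.
  by rewrite !mulmx0 raddf0 oppr0.
have : \tr (Q *m Om) = - \tr (Q *m Om).
  rewrite -[in LHS]PPOm mulmxA E; congr (- _).
  by rewrite -mulmxA mxtrace_mulC -mulmxA -mulmxA -[Om *m P]Om_comm PPOm.
lra.
Qed.

End para_contact_algebra.

Section ricci_algebra.
Variables (R : realFieldType) (m : nat).
Variables (P g : 'M[R]_m) (Om : 'I_m -> 'I_m -> 'M[R]_m).
Hypothesis g_sym : g^T = g.
Hypothesis g_unit : g \in unitmx.
Hypothesis g_P : g *m P^T = - (P *m g).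
Hypothesis OmC : forall i j, Om i j = - Om j i.
Hypothesis Om_skew : forall i j, (Om i j *m g)^T = - (Om i j *m g).
Hypothesis bianchi : forall i j k l, Om i j k l + Om j k i l + Om k i j l = 0.
Hypothesis Om_comm : forall i j, P *m Om i j = Om i j *m P.

Let K i j k l := (Om i j *m g) k l.

Let K12 i j k l : K i j k l = - K j i k l.
Proof. by rewrite /K OmC mulNmx oppmxE. Qed.

Let K34 i j k l : K i j k l = - K i j l k.
Proof. by rewrite /K -[LHS]opprK -oppmxE -Om_skew mxE. Qed.

Lemma lower_symmetry i j k l : K i j k l = K k l i j.
Proof.
apply: pair_symmetry => // {i j k l} i j k l; rewrite /K.
rewrite !mxE -!big_split big1// => a _ /=.
by rewrite -!mulrDl bianchi mul0r.
Qed.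

(* Pair symmetry turns the commutation of the curvature with [P] into         *)
(* R(Z, P X) = - R(P Z, X).                                                   *)
Lemma curv_endo_shift i k :
  \sum_a P i a *: Om k a = - \sum_a P k a *: Om a i.
Proof.
apply: (can_inj (mulmxK g_unit)); apply/matrixP => p q.
rewrite mulNmx oppmxE !mulmx_suml !summxE.
transitivity ((Om p q *m g *m P^T) k i).
  rewrite [RHS]mxE; apply: eq_bigr => a _.
  rewrite -scalemxAl [LHS]mxE [P^T _ _]mxE [LHS]mulrC; congr (_ * _).
  exact: lower_symmetry.
rewrite -mulmxA g_P mulmxN mulmxA -Om_comm oppmxE -mulmxA [X in - X]mxE.
congr (- _); apply: eq_bigr => a _.
rewrite -scalemxAl [RHS]mxE; congr (_ * _).
exact: lower_symmetry.
Qed.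

Let ric i j := \sum_a Om a i j a.

Lemma ric_sym i j : ric i j = ric j i.
Proof.
have E p q : ric p q = \sum_a \sum_l K a p q l * invmx g l a.
  apply: eq_bigr => a _.
  by rewrite -[in LHS](mulmxK g_unit (Om a p)) mxE.
rewrite !E exchange_big /=; apply: eq_bigr => a _; apply: eq_bigr => l _.
have -> : K l i j a = K a j i l by rewrite lower_symmetry K12 K34 opprK.
have -> : invmx g a l = (invmx g)^T l a by rewrite mxE.
by rewrite trmx_inv g_sym.
Qed.

Lemma ricci_trace i j :
  \sum_k \sum_a P i a * Om k a j k = 2^-1 * \tr (P *m Om i j).
Proof.
pose rho p q := \sum_k \sum_a P p a * Om k a q k.
have rhoE p q : rho p q = - \sum_k \sum_a P k a * Om a p q k.
  rewrite /rho -sumrN; apply: eq_bigr => k _.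
  transitivity ((\sum_a P p a *: Om k a) q k).
    by rewrite summxE; apply: eq_bigr => a _; rewrite mxE.
  rewrite curv_endo_shift oppmxE summxE; congr (- _).
  by apply: eq_bigr => a _; rewrite mxE.
have rho_ric p q : rho p q = \sum_a P p a * ric a q.
  rewrite /rho exchange_big /=; apply: eq_bigr => a _.
  by rewrite -mulr_sumr.
have rho_skew p q : rho p q = - rho q p.
  rewrite rhoE rho_ric; congr (- _).
  transitivity (\sum_a (P *m Om a p) q a).
    rewrite exchange_big /=; apply: eq_bigr => a _.
    by rewrite Om_comm mxE; apply: eq_bigr => k _; rewrite mulrC.
  under eq_bigr do rewrite mxE.
  rewrite exchange_big /=; apply: eq_bigr => b _; rewrite -mulr_sumr ric_sym.
  by [].
have : rho i j = \tr (P *m Om i j) + rho j i.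
  rewrite rhoE [rho j i]rhoE -sumrN /mxtrace -sumrN -big_split /=.
  apply: eq_bigr => k _; rewrite mxE -!sumrN -big_split /=; apply: eq_bigr => a _.
  have := bianchi a i j k; rewrite (OmC j a) oppmxE => B.
  by rewrite -mulrN -mulrN -mulrDr; congr (_ * _); lra.
rewrite -/(rho i j) [rho j i]rho_skew; lra.
Qed.

End ricci_algebra.

(** * Curvature in coordinates *)

HB.lock Definition christoffel_mx (R : realType) (m : nat)
    (g : 'rV[R]_m -> 'M[R]_m) (i : 'I_m) (x : 'rV[R]_m) : 'M[R]_m :=
  \matrix_(j, k) christoffel g x i j k.

Lemma christoffel_mxE (R : realType) (m : nat) (g : 'rV[R]_m -> 'M[R]_m) i x j k :
  christoffel_mx g i x j k = christoffel g x i j k.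
Proof. by rewrite unlock mxE. Qed.

(* Curvature acts on row vectors from the right, so the commutator of the     *)
(* connection matrices appears with the sign opposite to the usual one.       *)
HB.lock Definition curvature_mx (R : realType) (m : nat)
    (g : 'rV[R]_m -> 'M[R]_m) (i j : 'I_m) (x : 'rV[R]_m) : 'M[R]_m :=
  pd_mx i (christoffel_mx g j) x - pd_mx j (christoffel_mx g i) x
  + christoffel_mx g j x *m christoffel_mx g i x
  - christoffel_mx g i x *m christoffel_mx g j x.

Lemma curvature_mxE (R : realType) (m : nat) (g : 'rV[R]_m -> 'M[R]_m) i j :
  curvature_mx g i j = fun x =>
    pd_mx i (christoffel_mx g j) x - pd_mx j (christoffel_mx g i) x
    + christoffel_mx g j x *m christoffel_mx g i x
    - christoffel_mx g i x *m christoffel_mx g j x.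
Proof. by rewrite unlock. Qed.

Section curvature.
Variables (R : realType) (m : nat) (U : set 'rV[R]_m) (g : 'rV[R]_m -> 'M[R]_m).
Hypothesis U_open : open U.
Hypothesis g_smooth : smooth_mx U g.
Hypothesis g_sym : forall x, U x -> (g x)^T = g x.
Hypothesis g_unit : forall x, U x -> g x \in unitmx.

Local Notation G := (christoffel_mx g).
Local Notation Om := (curvature_mx g).

Lemma smooth_christoffel i : smooth_mx U (G i).
Proof.
move=> j k; apply: (smooth_eq U_open (fun x _ => esym (christoffel_mxE g i x j k))).
apply: smoothM => //; first exact: smooth_cst.
apply: smooth_sum => // l; apply: smoothM => //.
  exact: smooth_invmx.
apply: smoothD => //; last by apply: smoothN => //; exact/smooth_pd/g_smooth.
by apply: smoothD => //; exact/smooth_pd/g_smooth.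
Qed.

Lemma smooth_curvature i j : smooth_mx U (Om i j).
Proof.
have Gs k := smooth_christoffel k.
have GGs k l : smooth_mx U (fun x => G k x *m G l x) := smooth_mxM U_open (Gs k) (Gs l).
have dGs k l : smooth_mx U (pd_mx k (G l)) := smooth_mx_pd U_open k (Gs l).
have dGNs k l : smooth_mx U (fun x => - pd_mx k (G l) x) := smooth_mxN U_open (dGs k l).
have GGNs k l : smooth_mx U (fun x => - (G k x *m G l x)) := smooth_mxN U_open (GGs k l).
rewrite curvature_mxE.
exact: (smooth_mxD U_open (smooth_mxD U_open (smooth_mxD U_open (dGs i j) (dGNs j i))
  (GGs j i)) (GGNs i j)).
Qed.

Lemma pd_curvature i j k x : U x ->
  pd_mx i (Om j k) x =
    pd_mx i (pd_mx j (G k)) x - pd_mx i (pd_mx k (G j)) x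
    + (pd_mx i (G k) x *m G j x + G k x *m pd_mx i (G j) x)
    - (pd_mx i (G j) x *m G k x + G j x *m pd_mx i (G k) x).
Proof.
move=> Ux; have Gs l := smooth_christoffel l.
have GGs l l' : smooth_mx U (fun x => G l x *m G l' x) := smooth_mxM U_open (Gs l) (Gs l').
have dGs l l' : smooth_mx U (pd_mx l (G l')) := smooth_mx_pd U_open l (Gs l').
have dGNs l l' : smooth_mx U (fun x => - pd_mx l (G l') x) := smooth_mxN U_open (dGs l l').
have GGNs l l' : smooth_mx U (fun x => - (G l x *m G l' x)) := smooth_mxN U_open (GGs l l').
have D1 := smooth_mxD U_open (dGs j k) (dGNs k j).
have D2 := smooth_mxD U_open D1 (GGs k j).
rewrite curvature_mxE [LHS](pd_mxD U_open i D2 (GGNs j k) Ux).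
rewrite (pd_mxD U_open i D1 (GGs k j) Ux).
rewrite (pd_mxD U_open i (dGs j k) (dGNs k j) Ux).
rewrite (pd_mxN U_open i (dGs k j) Ux) (pd_mxN U_open i (GGs j k) Ux).
by rewrite !(pd_mxM U_open i (Gs _) (Gs _) Ux).
Qed.

Lemma second_bianchi i j k x : U x ->
  (pd_mx i (Om j k) x + Om j k x *m G i x - G i x *m Om j k x) +
  (pd_mx j (Om k i) x + Om k i x *m G j x - G j x *m Om k i x) +
  (pd_mx k (Om i j) x + Om i j x *m G k x - G k x *m Om i j x) = 0.
Proof.
move=> Ux; rewrite !pd_curvature// !curvature_mxE.
have C l l' p : pd_mx l (pd_mx l' (G p)) x = pd_mx l' (pd_mx l (G p)) x.
  exact: (pd_mxC U_open _ _ (smooth_christoffel p) Ux).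
rewrite (C k i j) (C k j i) (C j i k).
move: (pd_mx i (pd_mx j (G k)) x) (pd_mx i (pd_mx k (G j)) x) (pd_mx j (pd_mx k (G i)) x).
move: (pd_mx i (G j) x) (pd_mx i (G k) x) (pd_mx j (G i) x) (pd_mx j (G k) x)
  (pd_mx k (G i) x) (pd_mx k (G j) x) (G i x) (G j x) (G k x).
move=> ij ik ji jk ki kj a b c A B D.
rewrite !(mulmxDl, mulmxDr, mulmxBl, mulmxBr, mulNmx, mulmxN) !mulmxA.
by apply/matrixP => p q; rewrite !(addmxE, oppmxE) [RHS]mxE; ring.
Qed.

Lemma curvature_mxC i j x : Om i j x = - Om j i x.
Proof.
rewrite !curvature_mxE !opprD !opprK.
by apply/matrixP => p q; rewrite !(addmxE, oppmxE); ring.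
Qed.

Lemma first_bianchi i j k l x : U x ->
  Om i j x k l + Om j k x i l + Om k i x j l = 0.
Proof.
move=> Ux; rewrite !curvature_mxE !(addmxE, oppmxE).
have dC p q r : pd_mx p (G q) x r l = pd_mx p (G r) x q l.
  rewrite !pd_mxE; apply: (pd_eq U_open _ Ux) => y Uy.
  by rewrite !christoffel_mxE (christoffelC U_open g_sym).
have pC p q r : (G p x *m G q x) r l = (G r x *m G q x) p l.
  rewrite [LHS]mxE [RHS]mxE; apply: eq_bigr => c _; rewrite !christoffel_mxE.
  by rewrite (christoffelC U_open g_sym).
rewrite (dC i k j) (dC j i k) (dC k j i) (pC j i k) (pC k j i) (pC i k j).
ring.
Qed.

Lemma pd_metric i x : U x -> pd_mx i g x = G i x *m g x + g x *m (G i x)^T.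
Proof.
move=> Ux; apply/matrixP => j k.
rewrite pd_mxE (nabla_metric U_open g_sym g_unit)// addmxE.
rewrite [X in _ = X + _]mxE [X in _ = _ + X]mxE.
congr (_ + _); apply: eq_bigr => l _; rewrite ?[(_^T) _ _]mxE christoffel_mxE//.
by rewrite mulrC.
Qed.

Lemma curvature_skew i j x : U x -> (Om i j x *m g x)^T = - (Om i j x *m g x).
Proof.
move=> Ux.
have Gs l := smooth_christoffel l.
have GTs l := smooth_mxT U_open (Gs l).
have E p q : pd_mx p (pd_mx q g) x =
    pd_mx p (G q) x *m g x + G q x *m (G p x *m g x + g x *m (G p x)^T) +
    ((G p x *m g x + g x *m (G p x)^T) *m (G q x)^T + g x *m (pd_mx p (G q) x)^T).
  have Ggs := smooth_mxM U_open (Gs q) g_smooth.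
  have gGs := smooth_mxM U_open g_smooth (GTs q).
  rewrite (pd_mx_eq U_open _ Ux (fun y Uy => pd_metric q Uy)).
  rewrite (pd_mxD U_open p Ggs gGs Ux) (pd_mxM U_open p (Gs q) g_smooth Ux).
  by rewrite (pd_mxM U_open p g_smooth (GTs q) Ux) pd_metric// (pd_mxT U_open).
have := pd_mxC U_open i j g_smooth Ux; rewrite !E trmx_mul g_sym// curvature_mxE.
rewrite !(raddfD, raddfN) /= !trmx_mul.
move: (pd_mx i _ x) (pd_mx j _ x) (G i x) (G j x) (g x) => A B a b h.
rewrite !(mulmxDl, mulmxDr, mulmxBl, mulmxBr, mulNmx, mulmxN) !mulmxA.
move=> /matrixP H; apply/matrixP => p q; move: (H p q).
rewrite !(addmxE, oppmxE) => /eqP; rewrite -subr_eq0 => /eqP H'.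
by apply/eqP; rewrite -subr_eq0 -H'; apply/eqP; ring.
Qed.

Implicit Types X Y Z : 'rV[R]_m -> 'rV[R]_m.

Let cov j Z x := pd_mx j Z x + Z x *m G j x.

Lemma smooth_cov j Z : smooth_mx U Z -> smooth_mx U (cov j Z).
Proof.
move=> Zs; apply: smooth_mxD => //; first exact: smooth_mx_pd.
by apply: smooth_mxM => //; exact: smooth_christoffel.
Qed.

Lemma nablaE X Y x : smooth_mx U Y -> U x ->
  nabla g X Y x = \sum_i X x 0 i *: cov i Y x.
Proof.
move=> Ys Ux; rewrite /nabla (derive_pd_mx U_open _ Ys Ux).
under [RHS]eq_bigr do rewrite scalerDr.
rewrite big_split /=; congr (_ + _); apply/rowP => k.
rewrite mxE summxE; apply: eq_bigr => i _; rewrite !mxE mulr_sumr.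
by apply: eq_bigr => j _; rewrite christoffel_mxE mulrAC mulrC; congr (_ * _); exact: mulrC.
Qed.

Lemma nabla_eq X Y Y' x : (forall y, U y -> Y y = Y' y) -> U x ->
  nabla g X Y x = nabla g X Y' x.
Proof.
move=> YY' Ux; rewrite /nabla (YY' x Ux); apply: (congr1 (fun w => w + _)).
by apply: near_eq_derive; exact: (open_near U_open Ux YY').
Qed.

Lemma nabla_nablaE X Y Z x : smooth_mx U Y -> smooth_mx U Z -> U x ->
  nabla g X (nabla g Y Z) x =
  \sum_i \sum_j (X x 0 i * Y x 0 j) *: cov i (cov j Z) x +
  \sum_j ('D_(X x) Y x) 0 j *: cov j Z x.
Proof.
move=> Ys Zs Ux.
have YZs j : smooth_mx U (fun y => Y y 0 j *: cov j Z y).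
  by apply: smooth_mxZ => //; exact: smooth_cov.
rewrite (nabla_eq _ (fun y Uy => nablaE Y Zs Uy) Ux).
rewrite (nablaE _ (smooth_mx_sum U_open _ YZs) Ux) (derive_pd_mx U_open _ Ys Ux).
under [X in _ + X]eq_bigr do rewrite summxE scaler_suml.
rewrite [X in _ + X]exchange_big /= -big_split /=; apply: eq_bigr => i _.
rewrite -big_split /= {1}/cov (pd_mx_sum U_open _ _ YZs Ux) mulmx_suml -big_split /=.
rewrite scaler_sumr; apply: eq_bigr => j _.
rewrite (pd_mxZ U_open _ (Ys 0 j) (smooth_cov j Zs) Ux) -scalemxAl.
rewrite -addrA -scalerDr [LHS]scalerDr !scalerA [LHS]addrC; congr (_ *: _ + _ *: _).
by rewrite [RHS]mxE pd_mxE.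
Qed.

Lemma ricci_identity i j Z x : smooth_mx U Z -> U x ->
  cov i (cov j Z) x - cov j (cov i Z) x = Z x *m Om i j x.
Proof.
move=> Zs Ux.
have E p q : cov p (cov q Z) x = pd_mx p (pd_mx q Z) x +
    (pd_mx p Z x *m G q x + Z x *m pd_mx p (G q) x) +
    (pd_mx q Z x + Z x *m G q x) *m G p x.
  rewrite {1}/cov; congr (_ + _).
  rewrite (pd_mxD U_open p (smooth_mx_pd U_open q Zs)
    (smooth_mxM U_open Zs (smooth_christoffel q)) Ux).
  by rewrite (pd_mxM U_open p Zs (smooth_christoffel q) Ux).
rewrite !E (pd_mxC U_open j i Zs Ux) curvature_mxE.
move: (pd_mx i (pd_mx j Z) x) (pd_mx i (G j) x) (pd_mx j (G i) x) => A B D.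
move: (pd_mx i Z x) (pd_mx j Z x) (Z x) (G i x) (G j x) => zi zj z a b.
rewrite !(mulmxDl, mulmxDr, mulmxBl, mulmxBr, mulNmx, mulmxN) !mulmxA.
by apply/matrixP => p q; rewrite !(addmxE, oppmxE); ring.
Qed.

Lemma curvatureE X Y Z x :
  smooth_mx U X -> smooth_mx U Y -> smooth_mx U Z -> U x ->
  curvature g X Y Z x =
  \sum_i \sum_j (X x 0 i * Y x 0 j) *: (Z x *m Om i j x).
Proof.
move=> Xs Ys Zs Ux; rewrite /curvature !nabla_nablaE// nablaE//.
rewrite opprD addrACA -(addrA (_ - _)) -[RHS]addr0; congr (_ + _).
  rewrite [X in _ - X]exchange_big /= -sumrN -big_split /=.
  apply: eq_bigr => i _; rewrite -sumrN -big_split /=; apply: eq_bigr => j _.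
  by rewrite -(ricci_identity _ _ Zs Ux) scalerBr [Y x 0 j * _]mulrC.
apply/eqP; rewrite subr_eq0 -sumrN -big_split /=; apply/eqP.
apply: eq_bigr => j _; rewrite -scaleNr -scalerDl; congr (_ *: _).
by rewrite /lie_bracket addmxE oppmxE.
Qed.

Lemma smooth_frame i : smooth_mx U (@frame R m i).
Proof. exact: smooth_mx_cst. Qed.

Lemma smooth_apply_endo P Z : smooth_mx U P -> smooth_mx U Z ->
  smooth_mx U (apply_endo P Z).
Proof. by move=> Ps Zs; exact: (smooth_mxM U_open Zs Ps). Qed.

Lemma sum_frame (V : lmodType R) i x (F : 'I_m -> V) :
  \sum_a frame i x 0 a *: F a = F i.
Proof.
rewrite (bigD1 i)//= big1 ?addr0 => [|a ai]; rewrite mxE eqxx /= ?eqxx ?scale1r//.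
by rewrite (negbTE ai) scale0r.
Qed.

Lemma curvature_frame i X Z x : smooth_mx U X -> smooth_mx U Z -> U x ->
  curvature g (frame i) X Z x = \sum_a X x 0 a *: (Z x *m Om i a x).
Proof.
move=> Xs Zs Ux; rewrite (curvatureE (smooth_frame i) Xs Zs Ux).
under eq_bigr do (under eq_bigr do rewrite -scalerA; rewrite -scaler_sumr).
exact: sum_frame.
Qed.

Lemma frame_mul p i x (A : 'M[R]_(m, p)) : frame i x *m A = row i A.
Proof. by rewrite /frame -rowE. Qed.

Lemma ricci_endo_frame P i j x : smooth_mx U P -> U x ->
  ricci g (apply_endo P (frame i)) (frame j) x =
  \sum_k \sum_a P x i a * Om k a x j k.
Proof.
move=> Ps Ux; rewrite /ricci /mxtrace; apply: eq_bigr => k _; rewrite [LHS]mxE.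
rewrite (curvature_frame k (smooth_apply_endo Ps (smooth_frame i)) (smooth_frame j) Ux).
rewrite summxE; apply: eq_bigr => a _.
by rewrite /apply_endo !frame_mul !mxE.
Qed.

Lemma curvature_endo_comm P x : smooth_mx U P -> U x ->
  (forall i j k, curvature g (frame i) (frame j) (apply_endo P (frame k)) x =
     apply_endo P (curvature g (frame i) (frame j) (frame k)) x) ->
  forall i j, P x *m Om i j x = Om i j x *m P x.
Proof.
move=> Ps Ux comm i j; apply/row_matrixP => k.
have := comm i j k; rewrite /(apply_endo P (curvature _ _ _ _)).
have Fs := smooth_frame.
rewrite (curvature_frame i (Fs j) (smooth_apply_endo Ps (Fs k)) Ux).
rewrite (curvature_frame i (Fs j) (Fs k) Ux) !sum_frame /apply_endo.
by rewrite -!mulmxA !frame_mul.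
Qed.

End curvature.

(** * The Ricci form *)

Section closedness.
Variables (R : realType) (m : nat) (U : set 'rV[R]_m).
Variables (P g : 'rV[R]_m -> 'M[R]_m).
Variables (xi : 'rV[R]_m -> 'rV[R]_m) (eta : 'rV[R]_m -> 'cV[R]_m).
Hypothesis U_open : open U.
Hypotheses (P_smooth : smooth_mx U P) (g_smooth : smooth_mx U g).
Hypotheses (xi_smooth : smooth_mx U xi) (eta_smooth : smooth_mx U eta).
Hypothesis g_sym : forall x, U x -> (g x)^T = g x.
Hypothesis g_unit : forall x, U x -> g x \in unitmx.
Hypothesis P_square : forall x, U x -> P x *m P x = 1%:M - eta x *m xi x.
Hypothesis eta_xi : forall x, U x -> xi x *m eta x = 1%:M.
Hypothesis g_P : forall x, U x ->
  P x *m g x *m (P x)^T = - g x + eta x *m (eta x)^T.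
Hypothesis eta_g : forall x, U x -> (eta x)^T = xi x *m g x.

Local Notation Om := (curvature_mx g).

Hypothesis P_curv : forall i j x, U x -> P x *m Om i j x = Om i j x *m P x.

Lemma ricci_endo_trace i j x : U x ->
  ricci g (apply_endo P (frame i)) (frame j) x = 2^-1 * \tr (P x *m Om i j x).
Proof.
move=> Ux; rewrite (ricci_endo_frame U_open g_smooth g_unit _ _ P_smooth Ux).
have gP := metric_endo (P_square Ux) (eta_xi Ux) (g_P Ux) (eta_g Ux).
apply: (ricci_trace (g_sym Ux) (g_unit Ux) gP).
- by move=> *; exact: curvature_mxC.
- by move=> p q; exact: (curvature_skew U_open g_smooth g_sym g_unit p q Ux).
- by move=> p q r s; exact: (first_bianchi U_open g_sym p q r s Ux).
- by move=> p q; exact: P_curv.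
Qed.

Lemma trace_pd_endo_curv l i j x : U x -> \tr (pd_mx l P x *m Om i j x) = 0.
Proof.
move=> Ux.
apply: (mxtrace_deriv_endo_curv (g_sym Ux) (P_square Ux) (eta_xi Ux) (eta_g Ux)
  (P_curv i j Ux) (curvature_skew U_open g_smooth g_sym g_unit i j Ux)
  (a := pd_mx l eta x) (b := pd_mx l xi x)).
have xes : smooth_mx U (fun y => eta y *m xi y) := smooth_mxM U_open eta_smooth xi_smooth.
rewrite -(pd_mxM U_open l P_smooth P_smooth Ux) (pd_mx_eq U_open _ Ux P_square).
rewrite (pd_mxD U_open l (smooth_mx_cst U_open 1%:M) (smooth_mxN U_open xes) Ux).
rewrite pd_mx_cst add0r (pd_mxN U_open l xes Ux).
by rewrite (pd_mxM U_open l eta_smooth xi_smooth Ux).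
Qed.

Lemma pd_ricci_endo l i j x : U x ->
  pd l (fun y => ricci g (apply_endo P (frame i)) (frame j) y) x =
  2^-1 * \tr (P x *m (pd_mx l (Om i j) x + Om i j x *m christoffel_mx g l x
                      - christoffel_mx g l x *m Om i j x)).
Proof.
move=> Ux; have Oms := smooth_curvature U_open g_smooth g_unit i j.
have POs : smooth_mx U (fun y => P y *m Om i j y) := smooth_mxM U_open P_smooth Oms.
have tPOs : smooth U (fun y => \tr (P y *m Om i j y)).
  exact: (smooth_sum U_open _ xpredT (fun a => POs a a)).
rewrite (pd_eq U_open _ Ux (fun y Uy => ricci_endo_trace i j Uy)).
rewrite (pdM l (smooth_cst U_open _) tPOs Ux) pd_cst mul0r add0r.
rewrite (pd_mxtrace U_open l POs Ux) (pd_mxM U_open l P_smooth Oms Ux).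
rewrite raddfD /= trace_pd_endo_curv// add0r -addrA mulmxDr [in RHS]raddfD /=.
rewrite mulmxBr raddfB /= [P x *m (Om i j x *m _)]mulmxA P_curv//.
by rewrite -mulmxA [\tr (Om i j x *m _)]mxtrace_mulC -mulmxA subrr addr0.
Qed.

Lemma ricci_form_closed i j k x : U x ->
  pd i (fun y => ricci g (apply_endo P (frame j)) (frame k) y) x
  + pd j (fun y => ricci g (apply_endo P (frame k)) (frame i) y) x
  + pd k (fun y => ricci g (apply_endo P (frame i)) (frame j) y) x = 0.
Proof.
move=> Ux; rewrite !pd_ricci_endo// -!mulrDr -!mxtraceD -!mulmxDr.
by rewrite (second_bianchi U_open g_smooth g_unit)// mulmx0 raddf0 mulr0.
Qed.

End closedness.

Theorem proposition2 (R : realType) (n : nat) (n_gt0 : (0 < n)%N)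
    (M : smooth_manifold R n.*2.+1) (S : almost_para_contact_metric M)
    (weak : weakly_para_cosymplectic S) (leaves : para_kahler_leaves S) :
  closed_two_form (ricci_form S).
Proof.
move=> c x ca cx i j k; have U_open : open (ch_cod c) := @ch_cod_open _ _ _ c.
have Ps := smooth_smooth_mx U_open ((phi_tensor S).1 c ca).
have gs := smooth_smooth_mx U_open ((metric_tensor S).1.1 c ca).
have xis := smooth_smooth_mx U_open ((xi_tensor S).1 c ca).
have etas := smooth_smooth_mx U_open ((eta_tensor S).1 c ca).
have g_sym y (cy : ch_cod c y) := ((metric_tensor S).2 c y ca cy).1.
have g_unit y (cy : ch_cod c y) := ((metric_tensor S).2 c y ca cy).2.
have frame_smooth l : smooth (ch_cod c) (@frame R n.*2.+1 l).
  by move=> p; exact: class_C_cst.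
have phi_curv p q y (cy : ch_cod c y) :=
  curvature_endo_comm U_open gs g_unit Ps cy (fun p' q' r => weak.2 c ca _ _ _
    (frame_smooth p') (frame_smooth q') (frame_smooth r) y cy) p q.
rewrite -[RHS](ricci_form_closed U_open Ps gs xis etas g_sym g_unit
  (fun y => @phi_square _ _ _ S c y ca) (fun y => @eta_xi _ _ _ S c y ca)
  (fun y => @metric_phi _ _ _ S c y ca) (fun y => @eta_metric _ _ _ S c y ca)
  phi_curv i j k cx).
rewrite /ext_d2; congr (_ + _ + _); apply: (pd_eq U_open _ cx) => y _; exact: mxE.
Qed.
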